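(* Let $p$ be a prime, $q=p^l$, $m\ge1$, $n=2m$. Let $r=\rho(q-1)$ with $0\leqslant\rho\leqslant n-1$ and $\rho=2\rho'$ even, and let $I\subseteq M_r$ with $\{0,2\}\cap I=\{0\}$. Then the minimum weight codewords of $\mathcal{C}_q(r,I,n)^*$ are exactly the vectors $x=(x_g)_{g\in\mathbb{F}_{q^n}^*}$ for which there exist $\lambda\in\mathbb{F}_q^*$ and an $\mathbb{F}_{q^2}$-subspace $V\subseteq\mathbb{F}_{q^n}$ of dimension $m-\rho'$ over $\mathbb{F}_{q^2}$ such that $x_g=\lambda$ for $g\in V\setminus\{0\}$ and $x_g=0$ otherwise.
   Context: Let $N=q^n-1$ and $\alpha$ a primitive element of $\mathbb{F}_{q^n}$. Every integer $0\le u\le q^n-1$ is written $u=\sum_{i=0}^{n-1}u_iq^i$, $u_i\in\{0,\dots,q-1\}$; $\mathrm{wt}_q(u)=\sum u_i$, $O(u)=\sum_{i\text{ odd}}u_i$, $E(u)=\sum_{i\text{ even}}u_i$. For $-1\le r<n(q-1)$, $Z_r=\{\alpha^u\mid 0<u\le q^n-1,\ \mathrm{wt}_q(u)\le n(q-1)-r-1\}$. For $0\le r\le n(q-1)$ and integer $k\ge0$, $\Theta^{(r)}_k=\{\alpha^u\mid 0\le u\le q^n-1,\ \mathrm{wt}_q(u)=n(q-1)-r,\ |O(u)-E(u)|=k\}$. $M_r$ is the set of even (resp. odd) integers $k\in[0,m(q-1)]$ when $r$ is even (resp. odd). For $I\subseteq M_r$: $\overline I=M_r\setminus I$, $Z_{r,I}=Z_r\cup\bigcup_{k\in\overline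 I}\Theta^{(r)}_k$. $\mathcal{C}_q(r,I,n)^*$ is the cyclic code of length $N$ over $\mathbb{F}_q$ with coordinates indexed by $\mathbb{F}_{q^n}^*$ consisting of all $x=(x_g)$ with $\sum_g x_g g^{u}=0$ for every $u\in[1,N]$ with $\alpha^u\in Z_{r,I}$. Minimum weight is Hamming weight. *)

(* Defs.v *)
From HB Require Import structures.
From mathcomp Require Import all_boot all_order all_algebra all_field.
Set Implicit Arguments. Unset Strict Implicit. Unset Printing Implicit Defensive.
Import GRing.Theory.

(* F plays the role of F_q, L of F_{q^n} (a field extension of F);
   finvect_type L equips L with its (canonical) finite type structure. *)

Definition qdigit (q i u : nat) : nat := (u %/ q ^ i) %% q.
Definition wtq (q n u : nat) : nat := \sum_(i < n) qdigit q i u.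
Definition Oq (q n u : nat) : nat := \sum_(i < n | odd i) qdigit q i u.
Definition Eq (q n u : nat) : nat := \sum_(i < n | ~~ odd i) qdigit q i u.
Definition dOE (q n u : nat) : nat := (Oq q n u - Eq q n u) + (Eq q n u - Oq q n u).

Section Code.
Variables (F : finFieldType) (L : fieldExtType F).
Local Open Scope ring_scope.

Definition Zr (q n r : nat) (alpha : L) (z : L) : Prop :=
  exists u : nat, [/\ (0 < u)%N, (u <= q ^ n - 1)%N,
                     (wtq q n u + r.+1 <= n * (q - 1))%N & alpha ^+ u = z].

Definition Theta (q n r k : nat) (alpha : L) (z : L) : Prop :=
  exists u : nat, [/\ (u <= q ^ n - 1)%N, (wtq q n u + r = n * (q - 1))%N,
                     dOE q n u = k & alpha ^+ u = z].

Definition Mr (q m r k : nat) : bool := (k <= m * (q - 1))%N && (odd k == odd r).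

Definition ZrI (q m n r : nat) (I : pred nat) (alpha : L) (z : L) : Prop :=
  Zr q n r alpha z \/
  exists k : nat, [/\ Mr q m r k, ~~ I k & Theta q n r k alpha z].

Definition Lstar : predArgType := {g : finvect_type L | g != 0}.

Definition in_code (q m n r : nat) (I : pred nat) (alpha : L)
    (x : {ffun Lstar -> F}) : Prop :=
  forall u : nat, (1 <= u <= q ^ n - 1)%N -> ZrI q m n r I alpha (alpha ^+ u) ->
    \sum_(g : Lstar) (x g)%:A * (val g : L) ^+ u = 0.

Definition hweight (x : {ffun Lstar -> F}) : nat := #|[set g | x g != 0]|.

Definition min_weight_codeword (q m n r : nat) (I : pred nat) (alpha : L)
    (x : {ffun Lstar -> F}) : Prop :=
  [/\ in_code q m n r I alpha x, x != 0 &
      forall y, in_code q m n r I alpha y -> y != 0 -> (hweight x <= hweight y)%N].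

End Code.

(* Main.v *)
Require Import Defs.
From HB Require Import structures.
From mathcomp Require Import all_boot all_order all_algebra all_field.
From mathcomp Require Import zify.
Import GRing.Theory.
Local Open Scope ring_scope.

Set Implicit Arguments.
Unset Strict Implicit.
Unset Printing Implicit Defensive.

(** Put s = n - rho, Q = q^s, and let A_u = sum_g x_g g^u be the moments of a word x.
    The defining conditions give A_u = 0 for 0 < u < Q - 1, so the BCH argument shows
    that a nonzero codeword has at least Q - 1 nonzero coordinates.  If it has exactly
    Q - 1, let P be the monic polynomial of degree Q vanishing on the support and at 0.
    If rho = 0 then P = X^Q - X.  Otherwise, multiplying P by X^(Q-1-k) and taking moments
    expresses the coefficient of X^k in P through the moments A_(2Q-1-q^j) and higher
    coefficients of P.  For odd j the q-weight
    of 2Q-1-q^j is s(q-1) and |O - E| = 2, so this moment vanishes because 2 is not in I.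
    Hence P only involves the monomials X^(q^j) with j even: its roots form an
    F_(q^2)-subspace, and the Vandermonde relations make x constant on the support.

    Conversely, expand (sum_i c_i e_i)^u over an F_(q^2)-basis (e_i) of V into products of
    sums over F_(q^2) of c^(a + q b).  Such a sum is nonzero only if q^2 - 1 divides
    a + q b > 0, which forces a + b >= 2(q-1), with equality only for a = b = q - 1; so
    the moments of the indicator of V vanish in all degrees required by the code. *)

(** * Base-q digits, weights and their odd and even parts *)

Section Digits.
Local Open Scope nat_scope.

Variable q : nat.
Hypothesis q_gt1 : 1 < q.
Implicit Types (P : pred nat) (i j s n u e : nat).

Let q_gt0 : 0 < q. Proof. exact: ltnW. Qed.

(** Common form of [wtq], [Oq] and [Eq], taken at [xpredT], [odd] and its complement, so that each
    digit computation is done once. *)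
Definition digit_sum P n u : nat := \sum_(i < n | P i) qdigit q i u.

Lemma qdigit_high i s u : u < q ^ s -> s <= i -> qdigit q i u = 0.
Proof.
by move=> us si; rewrite /qdigit divn_small ?mod0n // (leq_trans us) ?leq_exp2l.
Qed.

Lemma sum_qdigits n u : u < q ^ n -> u = \sum_(i < n) qdigit q i u * q ^ i.
Proof.
suff {}H k : u = (u %/ q ^ k) * q ^ k + \sum_(i < k) qdigit q i u * q ^ i.
  by move=> un; rewrite {1}(H n) divn_small.
elim: k => [|k IH]; first by rewrite big_ord0 divn1; lia.
rewrite {1}IH big_ord_recr /= {2}/qdigit expnSr divnMA.
rewrite {1}(divn_eq (u %/ q ^ k) q) mulnDl -addnA [in RHS]mulnA [X in _ + X]addnC.
by rewrite mulnAC.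
Qed.

(** All s digits of q^s - 1 equal q - 1, so subtracting e causes no borrow. *)
Lemma qdigit_compl i s e : i < s -> e < q ^ s ->
  qdigit q i (q ^ s - 1 - e) + qdigit q i e = q - 1.
Proof.
have compl k a m : 0 < k -> a < k * m ->
    k * m - 1 - a = (m - 1 - a %/ k) * k + (k - 1 - a %% k) /\ a %/ k < m.
  move=> k0 am; have rk := ltn_pmod a k0; have dm : a %/ k < m.
    by rewrite ltn_divLR // mulnC.
  split=> //; rewrite {1}(divn_eq a k).
  move: (a %/ k) (a %% k) rk dm => d r rk dm.
  have [x ->] : exists x, m = x + d + 1 by exists (m - 1 - d); lia.
  rewrite !mulnDr muln1 ![k * _]mulnC addnK addnK.
  by move: (x * k) (d * k) => y z; lia.
move=> lt_is es; rewrite /qdigit.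
have qi0 : 0 < q ^ i by rewrite expn_gt0 q_gt0.
have Eqs : q ^ s = q ^ i * (q * q ^ (s - i.+1)).
  by rewrite -expnS -expnD; congr (_ ^ _); lia.
rewrite Eqs in es *.
have [-> lt1] := compl _ _ _ qi0 es.
rewrite divnMDl // [(_ - 1 - _) %/ _]divn_small ?addn0; last first.
  by have := ltn_pmod e qi0; move: (q ^ i) (e %% _) => b a; lia.
have [-> lt2] := compl _ _ _ q_gt0 lt1.
rewrite modnMDl modn_small; last by lia.
by have := ltn_pmod (e %/ q ^ i) q_gt0; lia.
Qed.

Lemma digit_sum_widen P n s u : s <= n -> u < q ^ s ->
  digit_sum P n u = digit_sum P s u.
Proof.
move=> sn us; rewrite /digit_sum [RHS](big_ord_widen_cond n P (fun i => qdigit q i u)) //.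
rewrite [LHS](bigID (fun i : 'I_n => i < s)) /= [X in _ + X]big1 ?addn0 // => i.
by rewrite -leqNgt => /andP[_ si]; exact: (qdigit_high us).
Qed.

Lemma digit_sum_compl P s e : e < q ^ s ->
  digit_sum P s (q ^ s - 1 - e) + digit_sum P s e = \sum_(i < s | P i) (q - 1).
Proof.
by move=> es; rewrite /digit_sum -big_split /=; apply: eq_bigr => i _; rewrite qdigit_compl.
Qed.

(** As e < q^s, adding q^s causes no carry: it only puts a digit 1 at position s. *)
Lemma digit_sum_addX P n s e : s < n -> e < q ^ s ->
  digit_sum P n (q ^ s + e) = digit_sum P s e + P s.
Proof.
move=> sn es; have qs_lt : q ^ s + e < q ^ s.+1 by rewrite expnS; nia.
rewrite (digit_sum_widen _ sn qs_lt) /digit_sum big_mkcond big_ord_recr /=.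
rewrite -big_mkcond /=; congr (_ + _); last first.
  rewrite /qdigit -{1}[q ^ s]mul1n divnMDl ?expn_gt0 ?q_gt0 //.
  by rewrite divn_small // modn_small //; case: (P s).
apply: eq_bigr => i _; rewrite /qdigit.
have -> : q ^ s = (q ^ (s - i.+1) * q) * q ^ i.
  by rewrite -expnSr -expnD; congr (_ ^ _); have := ltn_ord i; lia.
by rewrite divnMDl ?expn_gt0 ?q_gt0 // modnMDl.
Qed.

Lemma digit_sum0 P n : digit_sum P n 0 = 0.
Proof. by rewrite /digit_sum big1 // => i _; rewrite /qdigit div0n mod0n. Qed.

Lemma digit_sumX P n j : j < n -> digit_sum P n (q ^ j) = P j.
Proof.
by move=> jn; rewrite -[q ^ j]addn0 digit_sum_addX ?digit_sum0 ?expn_gt0 ?q_gt0.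
Qed.

Lemma wtq_eq0 s u : u < q ^ s -> wtq q s u = 0 -> u = 0.
Proof.
move=> us /eqP; rewrite sum_nat_eq0 => /forallP u0.
by rewrite (sum_qdigits us) big1 // => i _; rewrite (eqP (u0 i)).
Qed.

Lemma wtq_eq1 s u : u < q ^ s -> wtq q s u = 1 -> exists2 j, j < s & u = q ^ j.
Proof.
move=> us /eqP/sum_nat_eq1[i [_ ui u0]]; exists (nat_of_ord i) => //.
rewrite (sum_qdigits us) (bigD1 i) //= ui mul1n big1 ?addn0 // => j ji.
by rewrite u0.
Qed.

Lemma wtq_compl s u : u < q ^ s ->
  wtq q s (q ^ s - 1 - u) + wtq q s u = s * (q - 1).
Proof.
move=> us; have := digit_sum_compl xpredT us; rewrite /digit_sum /wtq => ->.
by rewrite sum_nat_const card_ord.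
Qed.

(** The complement q^s - 1 - u is nonzero, so it has positive weight. *)
Lemma wtq_lt n s u : s <= n -> u < q ^ s - 1 -> wtq q n u < s * (q - 1).
Proof.
move=> sn us; have us' : u < q ^ s by lia.
rewrite [wtq _ _ _](digit_sum_widen xpredT sn us') -(wtq_compl us').
case: (posnP (wtq q s (q ^ s - 1 - u))) => [/wtq_eq0 H|]; first by lia.
by rewrite /wtq /digit_sum; lia.
Qed.

Lemma sum_parity t (b : bool) c : \sum_(i < t.*2 | odd i == b) c = t * c.
Proof.
elim: t => [|t IH]; first by rewrite big_ord0.
rewrite doubleS big_mkcond !big_ord_recr -big_mkcond /= IH odd_double.
by case: b {IH} => /=; lia.
Qed.

Lemma wtqE n u : wtq q n u = Oq q n u + Eq q n u.
Proof. by rewrite /wtq (bigID (fun i : 'I_n => odd i)). Qed.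

(** The weight is s(q-1) + 1 minus that of q^s - 1 - e, and this complement, being neither 0 nor a
    power of q, has weight at least 2. *)
Lemma wtq_addX_lt n s e : s < n -> e < q ^ s - 1 ->
    (forall j, j < s -> e <> q ^ s - 1 - q ^ j) ->
  wtq q n (q ^ s + e) < s * (q - 1).
Proof.
move=> sn es neX; have es' : e < q ^ s by lia.
rewrite [wtq _ _ _](digit_sum_addX xpredT sn es') -(wtq_compl es').
have e's : q ^ s - 1 - e < q ^ s by lia.
case W: (wtq q s (q ^ s - 1 - e)) => [|[|k]].
- by have := wtq_eq0 e's W; lia.
- by have [j js E] := wtq_eq1 e's W; case: (neX j js); lia.
- by rewrite /wtq /digit_sum /=; lia.
Qed.

(** Removing q^j lowers O by 1, and q^(2t) sits at an even position and raises E by 1: the weight is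
    kept and the two sums, both t(q-1) before, end 2 apart. *)
Lemma dOE_addX n t j : t.*2 < n -> j < t.*2 -> odd j ->
  let u := q ^ t.*2 + (q ^ t.*2 - 1 - q ^ j) in
  wtq q n u = t.*2 * (q - 1) /\ dOE q n u = 2.
Proof.
move=> tn jt oj u; have qj : q ^ j < q ^ t.*2 by rewrite ltn_exp2l.
have es : q ^ t.*2 - 1 - q ^ j < q ^ t.*2 by lia.
have O : Oq q n u + 1 = t * (q - 1).
  rewrite [Oq _ _ _](digit_sum_addX odd tn es) odd_double addn0.
  have := digit_sum_compl odd qj; rewrite (digit_sumX _ jt) oj => ->.
  by rewrite -(sum_parity t true); apply: eq_bigl => i; rewrite eqb_id.
have E : Eq q n u = t * (q - 1) + 1.
  rewrite [Eq _ _ _](digit_sum_addX (predC odd) tn es) /= odd_double /=.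
  have := digit_sum_compl (predC odd) qj; rewrite (digit_sumX _ jt) /= oj /= addn0 => ->.
  by rewrite -(sum_parity t false); congr (_ + _); apply: eq_bigl => i; rewrite eqbF_neg.
by rewrite wtqE /dOE -addnn mulnDl E; split; lia.
Qed.

End Digits.

(** * Power sums over F_(q^2)-subspaces *)

(** If a + b <= 2(q-1), then a + qb <= 2q(q-1) < 2(q^2-1), so a + qb = q^2 - 1. Now b <= q-1 because
    qb <= q^2 - 1, and b >= q-1 by the bound on a + b; hence a = b = q-1. *)
Lemma Fq2_exponent q a b : (1 < q)%N -> (0 < a + q * b)%N ->
    (q ^ 2 - 1 %| a + q * b)%N ->
  (2 * (q - 1) <= a + b)%N /\ ((a + b = 2 * (q - 1))%N -> a = b).
Proof.
move=> q1 ab0 /dvdnP[k Ek].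
have k0 : (0 < k)%N by case: k Ek ab0 => // ->.
(* With q = r + 2 the truncated subtractions disappear, and q^2 - 1 factors as (r+1)(r+3). *)
have [r Eq] : exists r, (q = r + 2)%N by exists (q - 2)%N; lia.
suff H : (a + b <= 2 * (q - 1))%N -> a = b /\ (a + b = 2 * (q - 1))%N.
  split=> [|E]; last by case: (H (eq_leq E)).
  by case: leqP => // lt_ab; case: (H (ltnW lt_ab)) => _ E; rewrite E ltnn in lt_ab.
subst q; have -> : (r + 2 - 1 = r + 1)%N by lia.
have Eq2 : ((r + 2) ^ 2 - 1 = (r + 1) * (r + 3))%N by rewrite expnS expn1; nia.
rewrite {}Eq2 in Ek => le_ab.
have k1 : k = 1%N.
  case: k k0 Ek => [|[|k]] // _ Ek.
  have : (2 * ((r + 1) * (r + 3)) <= k.+2 * ((r + 1) * (r + 3)))%N.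
    by rewrite leq_mul2r orbT.
  by nia.
have Eb : (b = r + 1)%N by nia.
by rewrite k1 Eb in Ek *; split; nia.
Qed.

Section PowerSums.

Variables (E : finFieldType) (q : nat).
Hypotheses (q_gt1 : (1 < q)%N) (q0 : q%:R = 0 :> E).
Hypothesis FrobD : {morph (fun x : E => x ^+ q) : x y / x + y}.

Definition Fq2 : {pred E} := [pred c | c ^+ (q ^ 2) == c].

Hypothesis card_Fq2 : #|Fq2| = (q ^ 2)%N.

Variable beta : E.
Hypothesis prim_beta : (q ^ 2 - 1).-primitive_root beta.

Let q2_gt0 : (0 < q ^ 2)%N. Proof. by rewrite expn_gt0 ltnW. Qed.

Let beta_neq0 : beta != 0.
Proof.
have := prim_expr_order prim_beta; apply: contra_eq_neq => ->.
by rewrite expr0n eqn0Ngt (prim_order_gt0 prim_beta) eq_sym oner_eq0.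
Qed.

Lemma Fq2_beta : beta \in Fq2.
Proof.
by rewrite inE -(prednK q2_gt0) exprS -subn1 (prim_expr_order prim_beta) mulr1.
Qed.

Lemma Fq2M c d : c \in Fq2 -> c != 0 -> (c * d \in Fq2) = (d \in Fq2).
Proof. by rewrite !inE => /eqP Kc c0; rewrite exprMn Kc (inj_eq (mulfI c0)). Qed.

(** Multiplication by [beta] permutes F_(q^2) and scales the sum by beta^e, so the sum vanishes
    unless beta^e = 1. For e = 0 it is q^2 = 0 in E. *)
Lemma sum_Fq2_exp e : \sum_(c in Fq2) c ^+ e != 0 ->
  (0 < e)%N && (q ^ 2 - 1 %| e)%N.
Proof.
case: posnP => [-> | e0] /=.
  by rewrite big_const iter_addr_0 card_Fq2 natrX q0 expr0n eqxx.
rewrite (prim_order_dvd prim_beta); apply: contraR => be1; apply/eqP.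
apply: (mulfI (x := beta ^+ e - 1)); first by rewrite subr_eq0.
rewrite mulr0 mulrBl mul1r mulr_sumr; apply/eqP; rewrite subr_eq0; apply/eqP.
rewrite [RHS](reindex_inj (mulfI beta_neq0)); apply: eq_big => [c | c _].
  by rewrite Fq2M // Fq2_beta.
by rewrite exprMn.
Qed.

Lemma FrobXD j : {morph (fun x : E => x ^+ (q ^ j)) : x y / x + y}.
Proof.
elim: j => [|j IH] x y; first by rewrite !expr1.
by rewrite !expnSr !exprM IH FrobD.
Qed.

Lemma FrobX_sum j (I : finType) (P : pred I) (f : I -> E) :
  (\sum_(i | P i) f i) ^+ (q ^ j) = \sum_(i | P i) f i ^+ (q ^ j).
Proof.
by apply: (big_morph _ (@FrobXD j)); rewrite expr0n expn_eq0 eqn0Ngt (ltnW q_gt1).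
Qed.

Lemma Fq2_FrobX c j : c \in Fq2 -> c ^+ (q ^ j) = c ^+ (if odd j then q else 1%N).
Proof.
rewrite inE => /eqP Kc; rewrite -{1}(odd_double_half j) expnD mulnC exprM.
have -> : c ^+ (q ^ (j./2).*2) = c.
  elim: (j./2) => [|i IH]; first by rewrite expr1.
  by rewrite doubleS -addn2 expnD mulnC exprM Kc.
by case: odd; rewrite ?expn1.
Qed.

(** [T] indexes the Frobenius factors of a power and [lev] gives their levels. Frobenius is
    additive, so the product expands over maps f choosing a basis index for each factor. Each term
    splits into one power sum over F_(q^2) per index i, and a nonzero term yields the constraints of
    [Fq2_exponent] at every i. *)
Lemma power_sum_span (T : finType) (lev : T -> nat) t (e : 'I_t -> E) :
    \sum_(c in ffun_on Fq2) \prod_k (\sum_i c i * e i) ^+ (q ^ lev k) != 0 ->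
  (t * (2 * (q - 1)) <= #|T|)%N /\
  (#|T| = (t * (2 * (q - 1)))%N -> #|[pred k | odd (lev k)]| = #|[pred k | ~~ odd (lev k)]|).
Proof.
(* Exponent of c_i in the term of f: on F_(q^2), c^(q^j) is c for even j and c^q for odd j. *)
pose m (f : {ffun T -> 'I_t}) i := (\sum_(k | f k == i) (if odd (lev k) then q else 1))%N.
have expand : \sum_(c in ffun_on Fq2) \prod_k (\sum_i c i * e i) ^+ (q ^ lev k) =
    \sum_(f : {ffun T -> 'I_t}) (\prod_k e (f k) ^+ (q ^ lev k)) *
      \prod_i \sum_(c in Fq2) c ^+ m f i.
  transitivity (\sum_(c in ffun_on Fq2) \sum_(f : {ffun T -> 'I_t})
      (\prod_k e (f k) ^+ (q ^ lev k)) * \prod_i (c i : E) ^+ m f i).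
    apply: eq_bigr => c /ffun_onP Kc.
    under eq_bigr => k _ do rewrite FrobX_sum.
    rewrite bigA_distr_bigA; apply: eq_bigr => f _ /=.
    under eq_bigr => k _ do rewrite exprMn (Fq2_FrobX _ (Kc _)).
    rewrite big_split mulrC /=; congr (_ * _).
    rewrite (partition_big f xpredT) //=; apply: eq_bigr => i _.
    by rewrite -prodrXr; apply: eq_bigr => k /eqP ->.
  rewrite exchange_big /=; apply: eq_bigr => f _.
  by rewrite -mulr_sumr bigA_distr_big.
rewrite expand => /eqP nz.
have [f] : exists f : {ffun T -> 'I_t}, \prod_i \sum_(c in Fq2) c ^+ m f i != 0.
  apply/existsP/contraT; rewrite negb_exists => /forallP all0; case: nz.
  by rewrite big1 // => f _; have := all0 f; rewrite negbK => /eqP ->; rewrite mulr0.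
move=> /prodf_neq0 nzf.
pose b i := #|[pred k | (f k == i) && odd (lev k)]|.
pose a i := #|[pred k | (f k == i) && ~~ odd (lev k)]|.
have Em i : m f i = (a i + q * b i)%N.
  rewrite /m (bigID (fun k => odd (lev k))) /= addnC; congr (_ + _)%N.
    by rewrite /a -sum1_card; apply: eq_bigr => k /andP[_ /negbTE ->].
  rewrite /b mulnC -sum_nat_const; apply: eq_bigr => k; by case/andP=> _ ->.
have ab i : (2 * (q - 1) <= a i + b i)%N /\ ((a i + b i = 2 * (q - 1))%N -> a i = b i).
  by have := sum_Fq2_exp (nzf i isT); rewrite Em => /andP[]; exact: Fq2_exponent.
have part (P : pred T) : #|P| = (\sum_i #|[pred k | (f k == i) && P k]|)%N.
  rewrite -sum1_card (partition_big f xpredT) //=; apply: eq_bigr => i _.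
  by rewrite -sum1_card; apply: eq_bigl => k; rewrite inE andbC.
have cardT : #|T| = (\sum_i (a i + b i))%N.
  by rewrite -(cardC [pred k | ~~ odd (lev k)]) big_split /= !part; congr (_ + _)%N;
     apply: eq_bigr => i _; apply: eq_card => k; rewrite !inE ?negbK.
(* Equality in the summed bound forces equality at every index i. *)
have [le_ab eq_ab] := @leqif_sum 'I_t xpredT
  (fun i => 2 * (q - 1) == a i + b i)%N _ _ (fun i _ => leqif_eq (proj1 (ab i))).
rewrite sum_nat_const card_ord in le_ab eq_ab; rewrite cardT; split=> // /esym/eqP.
rewrite eq_ab => /forallP eqi; rewrite !part; apply: eq_bigr => i _.
by apply/esym/(proj2 (ab i)); have /eqP := eqi i.
Qed.

(** The index type holds as many copies of position i as the digit there, hence [wtq q n u]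
    elements: the shape [power_sum_span] expects. *)
Lemma expr_qdigits n u (g : E) : (u < q ^ n)%N ->
  g ^+ u = \prod_(k : {i : 'I_n & 'I_(qdigit q i u)}) g ^+ (q ^ tag k).
Proof.
move=> un; rewrite {1}(sum_qdigits q_gt1 un) prodrXr.
rewrite -(@sig_big_dep _ _ _ 'I_n (fun i => 'I_(qdigit q i u)) xpredT
  (fun _ _ => true) (fun i _ => q ^ i)%N) /=.
by congr (_ ^+ _); apply: eq_bigr => i _; rewrite sum_nat_const card_ord.
Qed.

Lemma card_qdigits n u (P : pred nat) :
  #|[pred k : {i : 'I_n & 'I_(qdigit q i u)} | P (tag k)]| = digit_sum q P n u.
Proof.
rewrite -sum1_card; under eq_bigl => k do rewrite inE -[P _]andbT.
rewrite -(@sig_big_dep _ _ _ 'I_n (fun i => 'I_(qdigit q i u)) P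
  (fun _ _ => true) (fun _ _ => 1)%N) /=.
by apply: eq_bigr => i _; rewrite sum_nat_const card_ord muln1.
Qed.

Lemma power_sum_digits n u t (e : 'I_t -> E) : (u < q ^ n)%N ->
    \sum_(c in ffun_on Fq2) (\sum_i c i * e i) ^+ u != 0 ->
  (t * (2 * (q - 1)) <= wtq q n u)%N /\
  (wtq q n u = (t * (2 * (q - 1)))%N -> Oq q n u = Eq q n u).
Proof.
move=> un; under eq_bigr => c _ do rewrite (expr_qdigits _ un).
move=> /power_sum_span; rewrite (card_qdigits n u odd) (card_qdigits n u (predC odd)).
by have := card_qdigits n u xpredT; rewrite /= => ->.
Qed.

End PowerSums.

(** * Moments and the locator polynomial *)

Section Moments.

Variable (E : finFieldType) (x : E -> E).

Definition moment u := \sum_(g | x g != 0) x g * g ^+ u.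

Lemma moment_horner (f : {poly E}) :
  \sum_(g | x g != 0) x g * f.[g] = \sum_(i < size f) f`_i * moment i.
Proof.
under [RHS]eq_bigr => i _ do rewrite mulr_sumr.
rewrite exchange_big; apply: eq_bigr => g _ /=; rewrite horner_coef mulr_sumr.
by apply: eq_bigr => i _; rewrite mulrCA.
Qed.

Definition locator (A : {set E}) : {poly E} := \prod_(h in A) ('X - h%:P).

Lemma locatorE A g : (locator A).[g] = \prod_(h in A) (g - h).
Proof. by rewrite horner_prod; apply: eq_bigr => h _; rewrite hornerXsubC. Qed.

Lemma root_locator A g : root (locator A) g = (g \in A).
Proof. by rewrite /locator -big_enum root_prod_XsubC mem_enum. Qed.

Lemma size_locator A : size (locator A) = #|A|.+1.
Proof. by rewrite /locator -big_enum size_prod_XsubC cardE. Qed.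

Lemma coef_locator_card A : (locator A)`_#|A| = 1.
Proof.
have /eqP := monic_prod_XsubC (enum A) xpredT id.
by rewrite lead_coefE big_enum -/(locator A) size_locator.
Qed.

Let S : {set E} := [set g | x g != 0].
Let S0 := 0 |: S.
Hypothesis x0 : x 0 = 0.

Lemma card_support0 : #|S0| = #|S|.+1.
Proof. by rewrite cardsU1 inE x0 eqxx. Qed.

(* The locator of S0 minus g has no constant term, so of its moments only the
   top one survives. *)
Lemma moment_isolate g : (forall u, (0 < u < #|S|)%N -> moment u = 0) ->
  x g != 0 -> x g * \prod_(h in S0 :\ g) (g - h) = moment #|S|.
Proof.
move=> mom0 xg; have g0 : g != 0 by apply: contraNneq xg => ->; rewrite x0.
have gS0 : g \in S0 by rewrite !inE xg orbT.
have cardS0g : #|S0 :\ g| = #|S|.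
  by apply/succn_inj; rewrite -card_support0 (cardsD1 g S0) gS0.
have f0 : (locator (S0 :\ g))`_0 = 0.
  by rewrite -horner_coef0; apply/rootP; rewrite root_locator !inE eqxx eq_sym g0.
have := moment_horner (locator (S0 :\ g)).
rewrite (bigD1 g) //= locatorE [X in _ + X]big1 ?addr0 => [-> | h /andP[xh hg]]; last first.
  by rewrite (rootP _) ?mulr0 // root_locator !inE hg xh orbT.
rewrite size_locator big_ord_recr /= coef_locator_card cardS0g mul1r big1 ?add0r //.
move=> [[|u] /= ltu] _; first by rewrite f0 mul0r.
by rewrite mom0 ?mulr0.
Qed.

Lemma moment_support_nz g : (forall u, (0 < u < #|S|)%N -> moment u = 0) ->
  x g != 0 -> moment #|S| != 0.
Proof.
move=> mom0 xg; rewrite -(moment_isolate mom0 xg) mulf_neq0 //.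
by apply/prodf_neq0 => h; rewrite !inE subr_eq0 eq_sym => /andP[].
Qed.

(** BCH bound: with a support smaller than d, the moment of degree #|S| would be zero by assumption
    and nonzero by [moment_support_nz]. *)
Lemma card_support_ge d g : x g != 0 ->
  (forall u, (0 < u < d)%N -> moment u = 0) -> (d <= #|S|)%N.
Proof.
move=> xg mom0; rewrite leqNgt; apply/negP => ltSd.
have mom0S u : (0 < u < #|S|)%N -> moment u = 0.
  by case/andP=> u0 uS; rewrite mom0 // u0 (ltn_trans uS).
have := moment_support_nz mom0S xg; rewrite mom0 ?eqxx // ltSd andbT.
by apply/card_gt0P; exists g; rewrite inE.
Qed.

(** For a in S0 the map b -> a - b permutes S0 and exchanges a with 0, so the product in
    [moment_isolate] does not depend on a; neither does x a. *)
Lemma support_const g h : (forall u, (0 < u < #|S|)%N -> moment u = 0) ->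
    {in S0 &, forall a b, a - b \in S0} ->
  x g != 0 -> x h != 0 -> x g = x h.
Proof.
move=> mom0 subS.
have prodE a : a \in S0 -> \prod_(b in S0 :\ a) (a - b) = \prod_(b in S0 :\ 0) b.
  move=> Sa; rewrite (reindex_inj (subrI a)) /=; apply: eq_big => [b|b _].
    rewrite !in_setD1 -[X in _ == X]subr0 (inj_eq (subrI a)); congr (_ && _).
    by apply/idP/idP => Sb; [rewrite -[b](subKr a)|]; exact: subS.
  by rewrite subKr.
have x_unique a : x a != 0 -> x a * \prod_(b in S0 :\ 0) b = moment #|S|.
  by move=> xa; rewrite -(moment_isolate mom0 xa) prodE // !inE xa orbT.
move=> xg xh; have := x_unique h xh; rewrite -(x_unique g xg) => /mulIf -> //.
by apply: contraNneq (moment_support_nz mom0 xg) => D0; rewrite -(x_unique g xg) D0 mulr0.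
Qed.

(** * The locator of a support of size q^s - 1 is a linearised polynomial in X^(q^2) *)

Section LocatorCoefs.

Variables q s : nat.
Hypotheses (q_gt1 : (1 < q)%N) (s_even : ~~ odd s).
Hypothesis card_S : #|S| = (q ^ s - 1)%N.
Hypothesis mom_low : forall u, (0 < u < q ^ s - 1)%N -> moment u = 0.
Hypothesis mom_high : forall e, (e < q ^ s - 1)%N ->
  (forall j, (j < s)%N -> ~~ odd j -> e <> (q ^ s - 1 - q ^ j)%N) ->
  moment (q ^ s + e) = 0.

Let P := locator S0.
Let qs_gt0 : (0 < q ^ s)%N. Proof. by rewrite expn_gt0 ltnW. Qed.
Let card_S0 : #|S0| = (q ^ s)%N.
Proof. by rewrite card_support0 card_S subn1 prednK. Qed.

Let P_eq0 k : (q ^ s < k)%N -> P`_k = 0.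
Proof. by move=> ltk; rewrite nth_default // size_locator card_S0. Qed.

Let moment_shift a : \sum_(k < (q ^ s).+1) P`_k * moment (a + k) = 0.
Proof.
transitivity (\sum_(g | x g != 0) x g * g ^+ a * P.[g]); last first.
  by apply: big1 => g xg; rewrite (rootP _) ?mulr0 // root_locator !inE xg orbT.
under [RHS]eq_bigr => g _ do rewrite horner_coef size_locator card_S0 mulr_sumr.
rewrite exchange_big; apply: eq_bigr => k _ /=; rewrite mulr_sumr.
by apply: eq_bigr => g _; rewrite exprD mulrCA !mulrA (mulrAC (x g)).
Qed.

(* Multiplying the locator by X^(q^s-1-k) puts its k-th coefficient in front of
   the nonzero moment of degree q^s-1; the other moments involved vanish, except
   in degrees 2q^s-1-q^j with j even, which carry coefficients known by induction. *)
Lemma locator_coef_eq0 k :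
    (forall j, ~~ odd j -> k <> (q ^ j)%N) -> P`_k = 0.
Proof.
have Pk0 : P`_0 = 0.
  by rewrite -horner_coef0; apply/rootP; rewrite root_locator !inE eqxx.
(* Descending induction on k, from the leading coefficient downwards. *)
have [d] := ubnP (q ^ s - k); elim: d k => // d IH k ltd neX.
have [->//|k0] := posnP k.
case: (ltngtP k (q ^ s)) => [ltk|/P_eq0//|/neX]; last by [].
have momS : moment (q ^ s - 1) != 0.
  have [g] : exists g, g \in S.
    by apply/card_gt0P; rewrite card_S; move: (q ^ s)%N ltk k0 => Q; lia.
  by rewrite inE -card_S => /moment_support_nz -> // u; rewrite card_S => /mom_low.
have ltkS : (k < (q ^ s).+1)%N by lia.
have := moment_shift (q ^ s - 1 - k).
rewrite (bigD1 (Ordinal ltkS)) //= big1 => [|i nik].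
  rewrite addr0 (_ : q ^ s - 1 - k + k = q ^ s - 1)%N; last by lia.
  by move/eqP; rewrite mulf_eq0 (negbTE momS) orbF => /eqP.
case: i nik => i /= lei nik; have {}nik : i <> k by move=> Ei; case/eqP: nik; apply: val_inj.
have [->|i0] := posnP i; first by rewrite Pk0 mul0r.
case: (ltnP i k) => [ltik|leki].
  by rewrite mom_low ?mulr0 //; move: (q ^ s)%N ltk => Q; lia.
rewrite (_ : q ^ s - 1 - k + i = q ^ s + (i - k.+1))%N; last first.
  by move: (q ^ s)%N ltk leki nik => Q; lia.
case: (boolP [exists j : 'I_s, ~~ odd j && (i - k.+1 == q ^ s - 1 - q ^ j)%N]).
  case/existsP=> j /andP[oj /eqP Ei].
  have ltj := ltn_ord j.
  have leqj : (q ^ j * 2 <= q ^ s)%N.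
    apply: leq_trans (leq_pexp2l (ltnW q_gt1) ltj).
    by rewrite expnSr leq_mul2l q_gt1 orbT.
  have qj0 : (0 < q ^ j)%N by rewrite expn_gt0 ltnW.
  have Eik : (i + q ^ j = k + q ^ s)%N.
    by move: (q ^ s)%N (q ^ j)%N Ei ltk leki nik leqj => Q R; lia.
  rewrite IH ?mul0r //; first by lia.
  (* Here i = q^s + k - q^j exceeds q^s / 2, so i = q^j' forces j' = s and then k = q^j, which is
     excluded. *)
  move=> j' oj' Ei'; case: (ltngtP j' s) => [ltj'|ltj'|Ej'].
  - have : (q ^ j' * 2 <= q ^ s)%N.
      apply: leq_trans (leq_pexp2l (ltnW q_gt1) ltj').
      by rewrite expnSr leq_mul2l q_gt1 orbT.
    by lia.
  - by move: lei; rewrite ltnS Ei' leq_exp2l // leqNgt ltj'.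
  - by apply: (neX j oj); move: Eik; rewrite Ei' Ej' addnC => /addIn.
move/existsPn => nej; rewrite mom_high ?mulr0 //.
  by move: (q ^ s)%N ltk leki nik lei => Q; lia.
by move=> j ltj oj; have := nej (Ordinal ltj); rewrite oj /= => /eqP.
Qed.

Hypothesis FrobD : {morph (fun x : E => x ^+ q) : x y / x + y}.

Lemma locator_coefP k : P`_k = 0 \/ exists2 j, ~~ odd j & k = (q ^ j)%N.
Proof.
(* Since j < q^j, searching below k decides whether k is such a power. *)
case: (boolP [exists j : 'I_k, ~~ odd j && (k == q ^ j)%N]) => [|/existsPn nej].
  by case/existsP=> j /andP[oj /eqP Ek]; right; exists (nat_of_ord j).
left; apply: locator_coef_eq0 => j oj Ek; have ltjk : (j < k)%N.
  by rewrite Ek ltn_expl.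
by have := nej (Ordinal ltjk); rewrite oj /= Ek eqxx.
Qed.

(** Every monomial occurring in P is a Frobenius power, so evaluation of P is additive and its roots
    are closed under sums. *)
Lemma support0D : {in S0 &, forall g h, g + h \in S0}.
Proof.
move=> g h; rewrite -!root_locator -/P => /rootP Pg /rootP Ph; apply/rootP.
rewrite -[RHS]addr0 -{1}Pg -Ph !horner_coef -big_split; apply: eq_bigr => i _ /=.
have [-> | [j _ ->]] := locator_coefP i; first by rewrite !mul0r addr0.
by rewrite (FrobXD FrobD) mulrDr.
Qed.

(** Even powers of Frobenius fix F_(q^2), so evaluation of P is F_(q^2)-linear. *)
Lemma support0_Fq2 c g : c \in Fq2 q -> g \in S0 -> c * g \in S0.
Proof.
move=> Kc; rewrite -!root_locator -/P => /rootP Pg; apply/rootP.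
rewrite -(mulr0 c) -Pg !horner_coef mulr_sumr; apply: eq_bigr => i _ /=.
have [-> | [j oj ->]] := locator_coefP i; first by rewrite !mul0r mulr0.
by rewrite exprMn (Fq2_FrobX _ Kc) (negbTE oj) mulrCA.
Qed.

End LocatorCoefs.
End Moments.

(** * Subspaces of the extension field *)

Section Extension.

Variables (F : finFieldType) (L : fieldExtType F).
Local Notation q := #|F|.
Local Notation E := (finvect_type L).

Let q_gt1 : (1 < q)%N. Proof. exact: finNzRing_gt1. Qed.

Lemma pchar_extension p l : prime p -> q = (p ^ l)%N -> p \in [pchar E].
Proof. by move=> pp qE; rewrite (fmorph_pchar (in_alg E)) (card_finPcharP qE). Qed.

Lemma natr_card_eq0 p l : prime p -> q = (p ^ l)%N -> q%:R = 0 :> E.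
Proof.
move=> pp qE; rewrite qE natrX (pcharf0 (pchar_extension pp qE)) expr0n.
by case: l qE q_gt1 => // ->.
Qed.

Lemma expr_cardD p l : prime p -> q = (p ^ l)%N ->
  {morph (fun x : E => x ^+ q) : x y / x + y}.
Proof.
move=> pp qE x y; apply: exprDn_pchar.
by rewrite qE pnatX pnatE // (pchar_extension pp qE).
Qed.

Lemma scalar_expr_card (a : F) : (a%:A : E) ^+ q = a%:A.
Proof. by rewrite -in_algE -rmorphXn /= expf_card. Qed.

Lemma closed_vspace (A : {set E}) : 0 \in A -> {in A &, forall g h, g + h \in A} ->
    (forall (a : F) g, g \in A -> a *: g \in A) ->
  {V : {vspace E} | V =i A}.
Proof.
move=> A0 AD AZ; exists <<enum A>>%VS => g; apply/idP/idP => [|Ag]; last first.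
  by rewrite memv_span ?mem_enum.
rewrite -[enum A]/(tval (in_tuple (enum A))) => /coord_span ->.
elim/big_ind: _ => // i _; apply: AZ; rewrite -mem_enum mem_nth //.
Qed.

(** The K-span of the first t vectors of a K-basis of E. *)
Lemma exists_submodule (K : {subfield E}) t : (t <= \dim_K {:E})%N ->
  exists2 V : {vspace E}, (K * V <= V)%VS & \dim_K V = t.
Proof.
rewrite -dim_vspaceOver ?subvf // => tleU.
set U := vspaceOver K _ in tleU; pose X := vbasis U : seq _.
have freeX : free (take t X).
  by apply: (@catl_free _ _ (drop t X)); rewrite cat_take_drop (basis_free (vbasisP U)).
have [V [defV KV _]] := vspaceOverP <<take t X>>%VS.
exists V => //; rewrite -(dim_vspaceOver KV) -defV.
by move: freeX; rewrite /free => /eqP ->; rewrite size_takel // size_tuple.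
Qed.

Lemma exists_Fq2_coords (K : {subfield E}) (V : {vspace E}) :
    K =i Fq2 q -> (K * V <= V)%VS ->
  exists e : 'I_(\dim_K V) -> E, forall h : E -> E,
    \sum_(g in V) h g = \sum_(c in ffun_on (Fq2 q)) h (\sum_i c i * e i).
Proof.
move=> KE KV; have [X _ [defV _]] := field_module_semisimple KV.
exists (fun i => X`_i) => h.
pose D := [pred c : {ffun 'I_(\dim_K V) -> E} | c \in ffun_on (Fq2 q)].
pose phi (c : {ffun 'I_(\dim_K V) -> E}) := \sum_i c i * X`_i.
have imD : phi @: D =i V.
  have VE g : (g \in V) = (g \in (\sum_(i < \dim_K V) K * <[X`_i]>)%VS) by rewrite defV.
  move=> g; rewrite VE; apply/imsetP/memv_sumP => [[c /ffun_onP Kc ->] | [v Kv ->]].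
    exists (fun i => c i * X`_i) => // i _.
    by apply/memv_cosetP; exists (c i); rewrite ?KE.
  have cP i : {c | c \in K & v i = c * X`_i} := sig2_eqW (memv_cosetP (Kv i isT)).
  exists [ffun i => s2val (cP i)].
    by apply/ffun_onP => i; rewrite ffunE -KE; case: (cP i).
  by apply: eq_bigr => i _; rewrite ffunE; case: (cP i).
(* The coordinate map is onto V; equal cardinalities make it injective without exhibiting a free
   family. *)
have cardD : #|D| = #|V|.
  have -> : #|D| = (#|@Fq2 E q| ^ #|'I_(\dim_K V)|)%N.
    by rewrite -card_ffun_on; apply: eq_card.
  by rewrite card_ord -(eq_card KE) !card_vspace -expnM mulnC -(dim_field_module KV).
have injD : {in D &, injective phi}.
  by apply/imset_injP; rewrite (eq_card imD) cardD.
by rewrite -(eq_bigl _ _ imD) big_imset.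
Qed.

Lemma exists_Fq2_subfield : {morph (fun x : E => x ^+ q) : x y / x + y} ->
  exists K : {subfield E}, K =i Fq2 q.
Proof.
move=> FrobD; have in2 (g : E) : (g \in [set c in Fq2 q]) = (g ^+ (q ^ 2) == g) by rewrite !inE.
have q2_gt0 : (0 < q ^ 2)%N by rewrite expn_gt0 ltnW.
have [||| V VE] := @closed_vspace [set c in Fq2 q].
- by rewrite in2 expr0n eqn0Ngt q2_gt0.
- by move=> g h; rewrite !in2 (FrobXD FrobD) => /eqP -> /eqP ->.
- move=> a g; rewrite !in2 exprZn => /eqP ->; apply/eqP; congr (_ *: _).
  by rewrite expnS expn1 exprM !expf_card.
have aV : is_aspace V.
  apply/andP; split; first by apply: has_algid1; rewrite VE in2 expr1n.
  by apply/prodvP => g h; rewrite !VE !in2 exprMn => /eqP -> /eqP ->.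
by exists (ASpace aV) => g; rewrite [LHS]VE inE.
Qed.

(** Identifies every K of degree 2 over F with the one copy of F_(q^2) in E. *)
Lemma subfield_dim2_Fq2 (K : {subfield E}) : #|@Fq2 E q| = (q ^ 2)%N ->
  \dim K = 2%N <-> K =i Fq2 q.
Proof.
move=> cardFq2; split=> [dK c | KE].
  by rewrite Fermat's_little_theorem dK.
by apply/eqP; rewrite -(eqn_exp2l _ _ q_gt1) -card_vspace (eq_card KE) cardFq2.
Qed.

(** The nonzero elements of [Fq2] are the roots of unity of order dividing q^2 - 1, that is, the
    powers of [beta]. *)
Lemma card_Fq2_primitive (beta : E) : (q ^ 2 - 1).-primitive_root beta ->
  #|@Fq2 E q| = (q ^ 2)%N.
Proof.
move=> pb; have q2_gt0 : (0 < q ^ 2)%N by rewrite expn_gt0 ltnW.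
have n0 := prim_order_gt0 pb.
have b0 : beta != 0 by rewrite (prim_root_eq0 pb) -lt0n.
pose f (i : 'I_(q ^ 2 - 1)) := beta ^+ i.
have injf : injective f.
  move=> i j /eqP; rewrite (eq_prim_root_expr pb) !modn_small //.
  by move/eqP/val_inj.
have -> : #|@Fq2 E q| = #|0 |: (f @: 'I_(q ^ 2 - 1))|.
  apply: eq_card => c; rewrite !inE; have [->|c0] := eqVneq c 0.
    by rewrite expr0n eqn0Ngt q2_gt0 eqxx.
  rewrite -{1}(subnK q2_gt0) addn1 exprS -[X in _ == X]mulr1 (inj_eq (mulfI c0)).
  apply/eqP/imsetP => [/(prim_rootP pb)[i ->] | [i _ ->]]; first by exists i.
  by rewrite /f exprAC (prim_expr_order pb) expr1n.
rewrite cardsU1 (card_imset _ injf) card_ord (_ : 0 \notin _) ?add1n ?subn1 ?prednK //.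
by apply/imsetP => -[i _ /esym/eqP]; rewrite expf_eq0 (negbTE b0) andbF.
Qed.

End Extension.

(** * Codewords *)

Section Words.

Variables (F : finFieldType) (L : fieldExtType F).
Local Notation q := #|F|.
Local Notation E := (finvect_type L).

(** Extension by 0 at the origin, with values moved into E, so that the results on moments apply. *)
Definition extend_word (x : {ffun Lstar L -> F}) (g : E) : E :=
  if insub g is Some h then (x h)%:A else 0.

Lemma extend_word_val x (h : Lstar L) : extend_word x (val h) = (x h)%:A.
Proof. by rewrite /extend_word valK. Qed.

Lemma extend_word0 x : extend_word x 0 = 0.
Proof. by rewrite /extend_word insubN ?eqxx. Qed.

Lemma scalar_eq0 (a : F) : ((a%:A : E) == 0) = (a == 0).
Proof. by rewrite scaler_eq0 oner_eq0 orbF. Qed.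

Lemma moment_extend_word x u :
  moment (extend_word x) u = \sum_(g : Lstar L) (x g)%:A * (val g : L) ^+ u.
Proof.
transitivity (\sum_(g : E | g != 0) extend_word x g * g ^+ u).
  rewrite /moment big_mkcond [RHS]big_mkcond; apply: eq_bigr => g _.
  have [->|_] := eqVneq g 0; first by rewrite extend_word0 eqxx.
  by have [->|] := eqVneq (extend_word x g) 0; rewrite ?mul0r.
rewrite (big_sub [pred g : E | g != 0]); apply: eq_bigr => h _.
exact: (congr1 (fun a => a * val h ^+ u) (extend_word_val x h)).
Qed.

Lemma card_support_extend_word x :
  #|[set g | extend_word x g != 0]| = hweight x.
Proof.
rewrite /hweight -(card_imset _ val_inj); apply: eq_card => g.
rewrite inE; apply/idP/imsetP => [|[h]]; last first.
  by rewrite inE => xh ->; rewrite extend_word_val scalar_eq0.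
rewrite /extend_word; case: insubP => [h _ <- | _]; last by rewrite eqxx.
by rewrite scalar_eq0 => xh; exists h; rewrite ?inE.
Qed.

Lemma word_neq0 (x : {ffun Lstar L -> F}) : x != 0 -> exists g, extend_word x g != 0.
Proof.
move=> x0; have /existsP[h xh] : [exists h, x h != 0].
  apply: contraNT x0; rewrite negb_exists => /forallP all0.
  by apply/eqP/ffunP => h; rewrite ffunE; apply/eqP; rewrite -[_ == _]negbK.
by exists (val h); rewrite extend_word_val scalar_eq0.
Qed.

End Words.

(** * Minimum weight words of the code *)

Section Codewords.

Variables (F : finFieldType) (L : fieldExtType F) (p l m n rho' : nat).
Variables (I : pred nat) (alpha : L).
Local Notation q := #|F|.
Local Notation E := (finvect_type L).
Let rho := (2 * rho')%N.
Let r := (rho * (q - 1))%N.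
Let t := (m - rho')%N.
Let s := t.*2.

Hypotheses (p_pr : prime p) (qE : q = (p ^ l)%N) (m_gt0 : (0 < m)%N).
Hypotheses (nE : n = (2 * m)%N) (dimL : \dim {: L} = n) (le_rho : (rho <= n - 1)%N).
Hypothesis prim_alpha : (q ^ n - 1).-primitive_root alpha.
Hypotheses (I0 : I 0) (I2 : ~~ I 2).

Let q_gt1 : (1 < q)%N. Proof. exact: finNzRing_gt1. Qed.
Let lt_rho' : (rho' < m)%N. Proof. by move: le_rho; rewrite nE /rho; lia. Qed.
Let t_gt0 : (0 < t)%N. Proof. by rewrite subn_gt0. Qed.
Let sE : (s + rho = n)%N. Proof. by rewrite /s /t /rho nE; lia. Qed.
Let le_sn : (s <= n)%N. Proof. by rewrite -sE leq_addr. Qed.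
Let wtE : (s * (q - 1) + r = n * (q - 1))%N. Proof. by rewrite -mulnDl sE. Qed.
Let FrobD : {morph (fun x : E => x ^+ q) : x y / x + y}.
Proof. exact: expr_cardD p_pr qE. Qed.

Let cardE : #|E| = (q ^ n)%N.
Proof. rewrite -dimL -(card_vspace {:E}).
by apply: eq_card => g; rewrite memvf. Qed.

(** As n is even, q^2 - 1 divides q^n - 1, and a suitable power of [alpha] works. *)
Lemma exists_Fq2_generator : exists beta : E, (q ^ 2 - 1).-primitive_root beta.
Proof.
have dvd : (q ^ 2 - 1 %| q ^ n - 1)%N.
  by rewrite nE expnM !subn1 [X in (_ %| X)%N]predn_exp dvdn_mulr.
by exists (alpha ^+ ((q ^ n - 1) %/ (q ^ 2 - 1))); exact: (dvdn_prim_root prim_alpha).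
Qed.

Let card_Fq2 : #|@Fq2 E q| = (q ^ 2)%N.
Proof. by have [b] := exists_Fq2_generator; exact: card_Fq2_primitive. Qed.

(** Weights below s(q-1) come from [Zr]. At weight s(q-1) the class k = 2 is available because 2 is
    not in I; it lies in M_r because r is even and 2 <= m(q-1). *)
Lemma in_code_moment x u : in_code q m n r I alpha x -> (0 < u <= q ^ n - 1)%N ->
    (wtq q n u < s * (q - 1))%N \/
    [/\ wtq q n u = s * (q - 1), dOE q n u = 2 & 2 <= m * (q - 1)]%N ->
  moment (extend_word x) u = 0.
Proof.
move=> Cx u_range wt_u; rewrite moment_extend_word; apply: Cx => //.
case: wt_u => [wt_u | [wt_u dOE_u le2]].
  by left; exists u; case/andP: u_range => u0 uN; split => //; rewrite -wtE; lia.
right; exists 2%N; split=> //.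
  by rewrite /Mr le2 /r /rho -mulnA mul2n odd_double.
by exists u; case/andP: u_range => u0 uN; split => //; rewrite wt_u wtE.
Qed.

(** Since 0 is in I, exponents of weight s(q-1) with O = E impose no condition. *)
Lemma moment_in_code x :
    (forall u, (0 < u <= q ^ n - 1)%N ->
      (wtq q n u < s * (q - 1))%N \/
      (wtq q n u = s * (q - 1))%N /\ Oq q n u <> Eq q n u ->
      moment (extend_word x) u = 0) ->
  in_code q m n r I alpha x.
Proof.
move=> mom0 u u_range Zu; rewrite -moment_extend_word; apply: mom0 => //.
have same v : (0 < v <= q ^ n - 1)%N -> alpha ^+ v = alpha ^+ u -> v = u.
  move=> /andP[v0 vN] /eqP; case/andP: u_range => u0 uN.
  (* Exponents range over [1, q^n - 1]; lowering both by 1 brings them into the range where residues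
     are unique. *)
  rewrite (eq_prim_root_expr prim_alpha) -(prednK v0) -(prednK u0) -(addn1 v.-1) -(addn1 u.-1) eqn_modDr.
  by rewrite !modn_small ?prednK // => /eqP ->.
case: Zu => [[v [v0 vN wt_v /same Ev]] | [k [_ Ik [v [vN wt_v dOE_v Ev]]]]].
  by left; rewrite -Ev ?v0 //; move: wt_v; rewrite -wtE; lia.
(* [Theta] admits exponent 0, but its weight 0 differs from s(q-1) > 0. *)
have v0 : (0 < v)%N.
  rewrite lt0n; apply: contra_eq_neq wt_v => ->.
  rewrite [wtq _ _ _](digit_sum0 _ xpredT) add0n -wtE.
  by have : (0 < s * (q - 1))%N; [rewrite muln_gt0 subn_gt0 q_gt1 double_gt0 t_gt0 | lia].
right; rewrite -(same v) ?v0 //; split; first by move: wt_v; rewrite -wtE; lia.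
by move=> OE; move: Ik; rewrite -dOE_v /dOE OE subnn I0.
Qed.

Lemma moment_low x : in_code q m n r I alpha x ->
  forall u, (0 < u < q ^ s - 1)%N -> moment (extend_word x) u = 0.
Proof.
move=> Cx u /andP[u0 us]; have le_qsn : (q ^ s <= q ^ n)%N by rewrite leq_exp2l.
apply: (in_code_moment Cx); first by rewrite u0; lia.
by left; exact: (wtq_lt q_gt1 le_sn us).
Qed.

Lemma hweight_ge x : in_code q m n r I alpha x -> x != 0 -> (q ^ s - 1 <= hweight x)%N.
Proof.
move=> Cx /word_neq0[g xg]; rewrite -card_support_extend_word.
exact: (card_support_ge (extend_word0 x) xg (moment_low Cx)).
Qed.

Let qs_gt1 : (1 < q ^ s)%N.
Proof. by rewrite -{1}(expn0 q) ltn_exp2l // double_gt0. Qed.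

Lemma hweight_neq0 (x : {ffun Lstar L -> F}) : hweight x = (q ^ s - 1)%N -> x != 0.
Proof.
move=> wx; apply: contra_eq_neq wx => ->; rewrite /hweight eq_card0 => [|g].
  by rewrite neq_ltn subn_gt0 qs_gt1.
by rewrite !inE ffunE eqxx.
Qed.

Section SubspaceWord.

Variables (K : {subfield E}) (V : {vspace E}) (lambda : F) (x : {ffun Lstar L -> F}).
Hypotheses (dimK : \dim K = 2%N) (KV : (K * V <= V)%VS) (dimV : \dim_K V = t).
Hypothesis xE : forall g : Lstar L, x g = if (val g : E) \in V then lambda else 0.

Lemma subspace_word_in_code : in_code q m n r I alpha x.
Proof.
apply: moment_in_code => u /andP[u0 uN] wt_u.
have [e sumE] := exists_Fq2_coords ((subfield_dim2_Fq2 K card_Fq2).1 dimK) KV.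
have [b prim_b] := exists_Fq2_generator.
suff sum0 : \sum_(g in V) g ^+ u = 0.
  rewrite moment_extend_word; transitivity (\sum_(g in V) lambda%:A * g ^+ u); last first.
    by rewrite -mulr_sumr sum0 mulr0.
  (* As u > 0, the origin contributes nothing to the sum over V. *)
  rewrite [RHS]big_mkcond [RHS](bigD1 0) //= mem0v expr0n eqn0Ngt u0 mulr0 add0r.
  rewrite (big_sub [pred g : E | g != 0]); apply: eq_bigr => h _.
  by rewrite xE; case: ifP => // _; rewrite scale0r mul0r.
have ltuN : (u < q ^ n)%N.
  by rewrite -ltnS -subSn ?expn_gt0 ?(ltnW q_gt1) // subn1 in uN.
rewrite sumE; apply/eqP; apply: contraT => /(power_sum_digits q_gt1 (natr_card_eq0 L p_pr qE) FrobD card_Fq2 prim_b ltuN).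
rewrite dimV (_ : t * (2 * (q - 1)) = s * (q - 1))%N; last by rewrite mulnA muln2.
by case: wt_u => [wt_u | [wt_u neqOE]] [lewt eqOE]; [lia | case: neqOE; exact: eqOE].
Qed.

Hypothesis lambda0 : lambda != 0.

Lemma hweight_subspace_word : hweight x = (q ^ s - 1)%N.
Proof.
have cardV : #|V| = (q ^ s)%N.
  by rewrite card_vspace (dim_field_module KV) dimV dimK muln2.
rewrite -cardV (cardD1 0) mem0v addKn /hweight -(card_imset _ val_inj).
apply: eq_card => g; rewrite !inE; apply/imsetP/andP => [[h] | [g0 Vg]].
  by rewrite inE xE => Vh ->; move: Vh; case: ifP; rewrite ?eqxx ?(valP h).
exists (Sub g g0 : Lstar L) => //; by rewrite inE xE /= Vg.
Qed.

End SubspaceWord.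

Lemma support0_closed x : in_code q m n r I alpha x -> hweight x = (q ^ s - 1)%N ->
  let S0 := 0 |: [set g | extend_word x g != 0] in
  {in S0 &, forall g h, g + h \in S0} /\
  (forall c g, c \in Fq2 q -> g \in S0 -> c * g \in S0).
Proof.
move=> Cx wx S0; rewrite -card_support_extend_word in wx.
(* If s = n, that is rho = 0, the support is all of E^* by counting. Otherwise 2q^s <= q^n keeps the
   degrees q^s + e within the range of the code. *)
have [lt_sn | ge_sn] := ltnP s n; last first.
  have S0T : S0 = setT.
    apply/eqP; rewrite eqEcard subsetT cardsT (card_support0 (extend_word0 x)) wx cardE.
    by rewrite (_ : s = n) ?subn1 ?prednK ?expn_gt0 ?(ltnW q_gt1) //; lia.
  by rewrite S0T; split=> [g h _ _|c g _ _]; exact: in_setT.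
have odd_s : ~~ odd s by rewrite odd_double.
have mom_high e : (e < q ^ s - 1)%N ->
    (forall j, (j < s)%N -> ~~ odd j -> e <> q ^ s - 1 - q ^ j)%N ->
    moment (extend_word x) (q ^ s + e) = 0.
  move=> lte ne; have le_qsn : (q ^ s * 2 <= q ^ n)%N.
    apply: leq_trans (leq_pexp2l (ltnW q_gt1) lt_sn).
    by rewrite expnSr leq_mul2l q_gt1 orbT.
  have qs0 : (0 < q ^ s)%N by rewrite expn_gt0 ltnW.
  apply: (in_code_moment Cx); first by lia.
  case: (boolP [exists j : 'I_s, e == q ^ s - 1 - q ^ j]%N) => [|/existsPn nej].
    case/existsP=> j /eqP Ee; have [oj|oj] := boolP (odd j); last by case: (ne j).
    have [wt_u dOE_u] := dOE_addX q_gt1 lt_sn (ltn_ord j) oj.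
    (* From 2t = s < n = 2m and t >= 1 follows m >= 2, so 2 <= m(q-1). *)
    right; rewrite Ee; split=> //; have : (2 <= m)%N.
      by move: lt_sn; rewrite /s /t nE; have := t_gt0; lia.
    by move: q_gt1 => q1 m2; have : (1 <= q - 1)%N; nia.
  left; apply: wtq_addX_lt => // j ltj Ee.
  by have := nej (Ordinal ltj); rewrite Ee eqxx.
split.
  exact: (support0D (extend_word0 x) q_gt1 odd_s wx (moment_low Cx) mom_high FrobD).
move=> c g.
exact: (support0_Fq2 (extend_word0 x) q_gt1 odd_s wx (moment_low Cx) mom_high).
Qed.

Lemma min_word_subspace x : in_code q m n r I alpha x -> hweight x = (q ^ s - 1)%N ->
  exists lambda : F, lambda != 0 /\
  exists K : {subfield E}, \dim K = 2%N /\
  exists V : {vspace E},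
    [/\ (K * V <= V)%VS, \dim_K V = t &
        forall g : Lstar L, x g = if (val g : E) \in V then lambda else 0].
Proof.
move=> Cx wx; have [S0D S0K] := support0_closed Cx wx.
move: S0D S0K; set S0 := 0 |: _ => S0D S0K.
have K_scal (a : F) : a%:A \in @Fq2 E q.
  by rewrite inE expnS expn1 exprM !scalar_expr_card.
have S0Z (a : F) g : g \in S0 -> a *: g \in S0.
  by move=> Sg; rewrite -[g]mul1r scalerAl; exact: S0K.
have S00 : 0 \in S0 by rewrite !inE eqxx.
have [V VE] := closed_vspace S00 S0D S0Z.
have [K KE] := exists_Fq2_subfield FrobD.
have dimK := (subfield_dim2_Fq2 K card_Fq2).2 KE.
have KV : (K * V <= V)%VS by apply/prodvP=> c g; rewrite KE !VE; exact: S0K.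
have qs0 : (0 < q ^ s)%N by rewrite expn_gt0 ltnW.
have dimV : \dim_K V = t.
  have /eqP : (q ^ \dim V = q ^ s)%N.
    rewrite -card_vspace (eq_card VE) (card_support0 (extend_word0 x)).
    by rewrite card_support_extend_word wx subn1 prednK.
  by rewrite eqn_exp2l // => /eqP ->; rewrite dimK /s -muln2 mulnK.
have [g xg] : exists g, extend_word x g != 0.
  have : (0 < #|[set g | extend_word x g != 0%R]|)%N.
    by rewrite card_support_extend_word wx subn_gt0 qs_gt1.
  by case/card_gt0P=> g; rewrite inE; exists g.
have supp_const := support_const (extend_word0 x).
have mom0 : forall u, (0 < u < #|[set g | extend_word x g != 0%R]|)%N ->
    moment (extend_word x) u = 0.
  by rewrite card_support_extend_word wx; exact: moment_low.
have subS : {in S0 &, forall a b, a - b \in S0}.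
  by move=> a b Sa Sb; rewrite -scaleN1r S0D ?S0Z.
have [lambda xgE] : exists lambda : F, extend_word x g = lambda%:A.
  by rewrite /extend_word; case: insubP => [h _ _|_]; [exists (x h) | exists 0; rewrite scale0r].
exists lambda; split; first by rewrite -(scalar_eq0 L) -xgE.
exists K; split=> //; exists V; split=> // h; rewrite VE !inE (negbTE (valP h)) /=.
rewrite extend_word_val scalar_eq0; case: eqP => [-> // | /eqP xh] /=.
apply: (fmorph_inj (in_alg E)); rewrite /= -extend_word_val -xgE.
by apply: supp_const => //; rewrite extend_word_val scalar_eq0.
Qed.

(** Shows that the bound q^s - 1 of [hweight_ge] is attained, hence is the minimum weight. *)
Lemma exists_subspace_word : exists y,
  [/\ in_code q m n r I alpha y, y != 0 & hweight y = (q ^ s - 1)%N].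
Proof.
have [K KE] := exists_Fq2_subfield FrobD.
have dimK := (subfield_dim2_Fq2 K card_Fq2).2 KE.
have [V KV dimV] : exists2 V : {vspace E}, (K * V <= V)%VS & \dim_K V = t.
  apply: exists_submodule; rewrite dimK (_ : \dim {:E} = n) // nE mulKn //.
  exact: leq_subr.
pose y := [ffun g : Lstar L => if (val g : E) \in V then 1 else 0 : F].
have yE (g : Lstar L) : y g = if (val g : E) \in V then 1 else 0 by rewrite ffunE.
have wy := hweight_subspace_word dimK KV dimV yE (oner_neq0 F).
exists y; split=> //; first exact: (subspace_word_in_code dimK KV dimV yE).
exact: hweight_neq0 wy.
Qed.

Lemma min_weight_codewordP x :
  min_weight_codeword q m n r I alpha x <->
  exists lambda : F, lambda != 0 /\
  exists K : {subfield E}, \dim K = 2%N /\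
  exists V : {vspace E},
    [/\ (K * V <= V)%VS, \dim_K V = t &
        forall g : Lstar L, x g = if (val g : E) \in V then lambda else 0].
Proof.
split=> [[Cx x0 min_x] | [lambda [lambda0 [K [dimK [V [KV dimV xE]]]]]]].
  have [y [Cy y0 wy]] := exists_subspace_word.
  apply: min_word_subspace => //; apply/eqP; rewrite eqn_leq -{1}wy min_x //=.
  exact: hweight_ge.
have wx := hweight_subspace_word dimK KV dimV xE lambda0.
split; first exact: (subspace_word_in_code dimK KV dimV xE).
  exact: hweight_neq0 wx.
by move=> y Cy y0; rewrite wx hweight_ge.
Qed.

End Codewords.

Theorem theorem5p6 (F : finFieldType) (L : fieldExtType F)
    (p l m n rho rho' : nat) (I : pred nat) (alpha : L) :
  prime p -> #|F| = (p ^ l)%N ->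
  (1 <= m)%N -> n = (2 * m)%N -> \dim {: L} = n ->
  (rho <= n - 1)%N -> rho = (2 * rho')%N ->
  (#|F| ^ n - 1).-primitive_root alpha ->
  (forall k, I k -> Mr #|F| m (rho * (#|F| - 1)) k) ->
  I 0%N -> ~~ I 2%N ->
  forall x : {ffun Lstar L -> F},
    min_weight_codeword #|F| m n (rho * (#|F| - 1)) I alpha x <->
    exists lambda : F, lambda != 0 /\
    exists K : {subfield L}, \dim K = 2%N /\
    exists V : {vspace L},
      [/\ (K * V <= V)%VS, \dim_K V = (m - rho')%N &
          forall g : Lstar L, x g = if (val g : L) \in V then lambda else 0].
Proof.
move=> p_pr qE m_gt0 nE dimL le_rho rhoE prim_alpha _ I0 I2 x; subst rho.
exact: (min_weight_codewordP p_pr qE m_gt0 nE dimL le_rho prim_alpha I0 I2 x).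
Qed.
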